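(* Let $G=(V,E)$ be a finite graph without loops and parallel edges, with $|E|=n$ and edges numbered $e_1,\dots,e_n$ (coordinate $x_i$ of $\mathbb{R}^n$ corresponds to edge $e_i$). Let $P(G)\subseteq\mathbb{R}^n$ be the matching polyhedron of $G$, let $L(P(G))$ be the set of LP-orientations of $P(G)$, and let $RG(MA(G))$ be the set of regions of the matching arrangement $MA(G)$. For an LP-orientation $O$ define \[F(O)=\{(\alpha_1,\dots,\alpha_n)\in\mathbb{R}^n \mid \text{the linear function } f(x)=\alpha_1x_1+\dots+\alpha_nx_n \text{ induces } O\}.\] Then: (1) for every $O\in L(P(G))$, the set $F(O)$ is a region of $MA(G)$, i.e. $F(O)\in RG(MA(G))$; hence $F$ can be regarded as a map $L(P(G))\to RG(MA(G))$; (2) the map $F:L(P(G))\to RG(MA(G))$ is a bijection.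
   Context: Paths and cycles: a sequence of edges $(r_1,\dots,r_k)$ in which $r_j$ and $r_{j+1}$ share a vertex for all $j$ is a path; if moreover $r_k$ and $r_1$ share a vertex it is a cycle. It is simple if no pair of edges shares a vertex other than the consecutive pairs $(r_j,r_{j+1})$ (and $(r_k,r_1)$ for a cycle). Its length is the number of edges. Matching arrangement $MA(G)$: for every sequence of edges $(e_{i_1},e_{i_2},\dots,e_{i_k})$ forming a simple path, or a simple cycle of even length, in $G$, take the hyperplane $x_{i_1}-x_{i_2}+x_{i_3}-\dots+(-1)^{k+1}x_{i_k}=0$ in $\mathbb{R}^n$; $MA(G)$ is the set of all such hyperplanes. A region of $MA(G)$ is a connected component of the complement in $\mathbb{R}^n$ of the union of these hyperplanes. Matching polyhedron $P(G)$: the convex polyhedron in $\mathbb{R}^n$ defined by the inequalities $x_i\ge 0$ for every edge $e_i$; $\sum_{e_i\ni v}x_i\le 1$ for every vertex $v$; and $\sum_{e_i=(v_p,v_q),\,v_p,v_q\in S}x_i\le k$ for every vertex subset $S$ with $|S|=2k+1$. (Its vertices are exactly the $0/1$ incidence vectors of the matchings of $G$.) LP-orientation: if $\phi:\mathbb{R}^n\to\mathbb{R}$ is a linear function taking different values at any two adjacent vertices of $P(G)$, it induces an orientation of the graph (1-skeleton) of $P(G)$ by orienting each edge $(v_i,v_j)$ from $v_i$ to $v_j$ when $\phi(v_i)<\phi(v_j)$. An orientation of the graph of $P(G)$ arising this way from some linear function is an LP-orientation. *)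

(* Defs.v *)
From HB Require Import structures.
From mathcomp Require Import all_boot all_order all_algebra.
From mathcomp Require Import boolp classical_sets functions reals topology normedtype.

Set Implicit Arguments.
Unset Strict Implicit.
Unset Printing Implicit Defensive.

Import Order.TTheory GRing.Theory Num.Theory.
Import numFieldNormedType.Exports.

Local Open Scope classical_set_scope.
Local Open Scope ring_scope.

(* An edge is the 2-element set of its endpoints; injectivity excludes parallel
   edges, so that the edge set has exactly n elements. *)
Record numbered_graph (V : finType) (n : nat) := NumberedGraph {
  edge :> 'I_n -> {set V};
  card_edge : forall i, #|edge i| = 2;
  edge_inj : injective edge
}.

Section EdgeSequences.
Variables (V : finType) (n : nat) (G : numbered_graph V n).

Definition share_vertex (i j : 'I_n) : Prop := exists v, v \in G i /\ v \in G j.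

(* A sequence of k.+1 edges is given by the indices r 0, ..., r k, so that it
   is nonempty and has length k.+1. *)
Definition is_path k (r : 'I_k.+1 -> 'I_n) : Prop :=
  forall a b : 'I_k.+1, b = a.+1 :> nat -> share_vertex (r a) (r b).

Definition is_cycle k (r : 'I_k.+1 -> 'I_n) : Prop :=
  is_path r /\ share_vertex (r ord_max) (r ord0).

(* Injectivity only rules out an immediate repetition (e, e) of an edge, since
   a nonconsecutive repetition violates the condition on shared vertices. *)
Definition simple_path k (r : 'I_k.+1 -> 'I_n) : Prop :=
  [/\ is_path r, injective r
    & forall a b : 'I_k.+1, (a < b)%N -> share_vertex (r a) (r b) ->
        b = a.+1 :> nat].

Definition simple_cycle k (r : 'I_k.+1 -> 'I_n) : Prop :=
  [/\ is_cycle r, injective r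
    & forall a b : 'I_k.+1, (a < b)%N -> share_vertex (r a) (r b) ->
        b = a.+1 :> nat \/ (a = ord0 /\ b = ord_max)].

End EdgeSequences.

Section MatchingArrangement.
Variables (R : realType) (V : finType) (n : nat) (G : numbered_graph V n).

Definition alternating_hyperplane k (r : 'I_k.+1 -> 'I_n) : set 'rV[R]_n :=
  [set x | \sum_(j < k.+1) (-1) ^+ j * x 0 (r j) = 0].

Definition matching_arrangement : set (set 'rV[R]_n) :=
  [set H | exists k (r : 'I_k.+1 -> 'I_n),
     (simple_path G r \/ (simple_cycle G r /\ ~~ odd k.+1)) /\
     H = alternating_hyperplane r].

End MatchingArrangement.
Arguments matching_arrangement R {V n} G.

Definition regions (R : realType) (n : nat) (A : set (set 'rV[R]_n)) :
    set (set 'rV[R]_n) :=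
  let C := ~` (\bigcup_(H in A) H) in
  [set D | exists2 x, C x & D = connected_component C x].

Definition linear_form (R : realType) (n : nat) (alpha x : 'rV[R]_n) : R :=
  \sum_(i < n) alpha 0 i * x 0 i.

Definition matching_polyhedron (R : realType) (V : finType) (n : nat)
    (G : numbered_graph V n) : set 'rV[R]_n :=
  [set x | [/\ forall i, 0 <= x 0 i,
     forall v : V, \sum_(i < n | v \in G i) x 0 i <= 1
   & forall (S : {set V}) (k : nat), #|S| = k.*2.+1 ->
       \sum_(i < n | G i \subset S) x 0 i <= k%:R]].
Arguments matching_polyhedron R {V n} G.

Section Skeleton.
Variables (R : realType) (n : nat) (P : set 'rV[R]_n).

Definition is_face (Q : set 'rV[R]_n) : Prop :=
  exists (c : 'rV[R]_n) (b : R), (forall x, P x -> linear_form c x <= b) /\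
    Q = P `&` [set x | linear_form c x = b].

Definition is_vertex (u : 'rV[R]_n) : Prop := is_face [set u].

Definition segment (u v : 'rV[R]_n) : set 'rV[R]_n :=
  [set x | exists t : R, [/\ 0 <= t, t <= 1 & x = (1 - t) *: u + t *: v]].

(* For a bounded polyhedron, such as the matching polyhedron, the
   one-dimensional faces are the segments joining two distinct vertices. *)
Definition adjacent (u v : 'rV[R]_n) : Prop :=
  [/\ is_vertex u, is_vertex v, u <> v & is_face (segment u v)].

(* An orientation of the 1-skeleton is the set of its arcs (tail, head). *)
Definition induces (f : 'rV[R]_n -> R) (O : set ('rV[R]_n * 'rV[R]_n)) : Prop :=
  (forall u v, adjacent u v -> f u <> f v) /\
  O = [set a | adjacent a.1 a.2 /\ f a.1 < f a.2].

Definition LP_orientations : set (set ('rV[R]_n * 'rV[R]_n)) :=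
  [set O | exists phi : {linear 'rV[R]_n -> R^o}, induces phi O].

Definition inducing_coefficients (O : set ('rV[R]_n * 'rV[R]_n)) :
    set 'rV[R]_n :=
  [set alpha | induces (linear_form alpha) O].

End Skeleton.

(* Main.v *)
(** The vertices of [P(G)] are the indicators of matchings (Edmonds): for a linear function
    [c], either [c = 0] or some inequality defining [P(G)] is tight at all [c]-optimal
    matchings (Lovasz), and subtracting a suitable multiple of it from [c] enlarges the set of
    optimal matchings; iterating down to [c = 0] bounds [c] on [P(G)] by its value at a matching.

    Two matchings [M], [N] are adjacent iff their symmetric difference is a single simple path
    or even simple cycle. If [K] is a connected component of the difference, swapping [M] and
    [N] along [K] gives two matchings with the same midpoint, hence on the face [[M, N]], so
    [K] is the whole difference. Hence the differences of adjacent vertices are, up to sign,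
    the normal vectors of the hyperplanes of [MA(G)]: an orientation amounts to a
    sign vector of the arrangement, and the points with a given sign vector form a region. *)

Require Import Defs.
From HB Require Import structures.
From mathcomp Require Import all_boot all_order all_algebra all_fingroup.
From mathcomp Require Import reals.
From mathcomp Require Import zify ring lra.

Set Implicit Arguments.
Unset Strict Implicit.
Unset Printing Implicit Defensive.

Import Order.TTheory GRing.Theory Num.Theory.

Local Open Scope ring_scope.

(** * Matchings *)

Section Matchings.
Variables (V : finType) (n : nat) (G : numbered_graph V n).
Implicit Types (M N K : {set 'I_n}) (S : {set V}) (u v w t : V).

Lemma edge_endpoints i u v w :
  u \in G i -> v \in G i -> u != v -> w \in G i -> w = u \/ w = v.
Proof.
move=> ui vi uv wi; have /eqP/cards2P[a [b [ab Gi]]] := card_edge G i.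
move: ui vi wi uv; rewrite Gi !inE.
by do 3![case/orP => /eqP ->]; rewrite ?eqxx //; auto.
Qed.

Definition matching M :=
  [forall i in M, forall j in M, (i != j) ==> [disjoint G i & G j]].

Lemma matchingP M : reflect
  (forall v i j, i \in M -> j \in M -> v \in G i -> v \in G j -> i = j) (matching M).
Proof.
apply: (iffP idP) => [mM v i j iM jM vi vj|mM].
  apply/eqP; apply: contraTT mM => nij; apply/forall_inPn; exists i => //.
  apply/forall_inPn; exists j => //; rewrite nij /=.
  by apply/pred0Pn; exists v; rewrite /= vi vj.
apply/forall_inP => i iM; apply/forall_inP => j jM; apply/implyP => nij.
apply/pred0P => v /=; apply: contraNF nij => /andP[vi vj].
by apply/eqP; apply: (mM v).
Qed.

Lemma matching_sub M N : N \subset M -> matching M -> matching N.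
Proof.
move=> /subsetP NM /matchingP mM; apply/matchingP => v i j iN jN.
by apply: mM; apply: NM.
Qed.

Lemma matching0 : matching set0.
Proof. by apply/matchingP => v i j; rewrite inE. Qed.

Lemma matching1 i : matching [set i].
Proof. by apply/matchingP => v j k /set1P -> /set1P ->. Qed.

Lemma degree_le1 M v : matching M -> (#|[set i in M | v \in G i]| <= 1)%N.
Proof.
move=> /matchingP mM; apply/card_le1_eqP => i j.
by rewrite !inE => /andP[iM vi] /andP[jM vj]; apply: (mM v).
Qed.

Lemma sum_degree M S :
  (\sum_(v in S) #|[set i in M | v \in G i]| = \sum_(i in M) #|G i :&: S|)%N.
Proof.
under eq_bigr do rewrite -sum1dep_card big_mkcondr.
rewrite exchange_big; apply: eq_bigr => i iM.
rewrite -big_mkcondr -sum1_card; apply: eq_bigl => v.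
by rewrite inE andbC.
Qed.

(** Counts incidences with [S]: an edge inside contributes two, and a vertex carries at most one. *)
Lemma card_edges_inside M S : matching M ->
  (2 * #|[set i in M | G i \subset S]| <= #|S|)%N.
Proof.
move=> mM; apply: (@leq_trans (\sum_(v in S) #|[set i in M | v \in G i]|)).
  rewrite sum_degree mulnC -sum_nat_const.
  rewrite [leqRHS](bigID (fun i => G i \subset S)) /=.
  apply: leq_trans (leq_addr _ _); apply: eq_leq.
  apply: eq_big => [i|i]; rewrite inE // => /andP[_ /setIidPl ->].
  by rewrite card_edge.
by rewrite -sum1_card; apply: leq_sum => v _; apply: degree_le1.
Qed.

Definition swap K M N := (M :\: K) :|: (N :&: K).

(** [K] cuts [M] along connected components. For a union of two matchings this rules out conflicts
    between the swapped and the kept edges. *)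
Definition separated K M := forall i j v, i \in M -> j \in M ->
  i \in K -> v \in G i -> v \in G j -> j \in K.

Lemma matching_swap K M N : separated K (M :|: N) ->
  matching M -> matching N -> matching (swap K M N).
Proof.
move=> sK /matchingP mM /matchingP mN; apply/matchingP => v i j.
rewrite !inE => /orP[/andP[iK iM]|/andP[iN iK]] /orP[/andP[jK jM]|/andP[jN jK]] vi vj.
- exact: (mM v).
- by rewrite (sK j i v) ?inE ?iM ?jN ?orbT // in iK.
- by rewrite (sK i j v) ?inE ?jM ?iN ?orbT // in jK.
- exact: (mN v).
Qed.

Definition missed M v := [forall i in M, v \notin G i].

Lemma missed_out M v i : missed M v -> i \in M -> v \in G i = false.
Proof. by move=> /forall_inP h /h /negPf. Qed.

(** For a matching, the default [v] makes this a total involution whose fixed points are the missed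
    vertices. *)
Definition partner M v :=
  if [pick i in M | v \in G i] is Some i then odflt v [pick w in G i :\ v] else v.

Lemma partner_missed M v : missed M v -> partner M v = v.
Proof.
move=> mv; rewrite /partner; case: pickP => // i /andP[iM].
by rewrite (missed_out mv iM).
Qed.

Lemma partner_edge M i v : matching M -> i \in M -> v \in G i ->
  partner M v \in G i :\ v.
Proof.
move=> /matchingP mM iM vi; rewrite /partner; case: pickP => [j /andP[jM vj]|/(_ i)].
  rewrite (mM v j i) //; case: pickP => //= noW.
  have /eqP/cards2P[a [b [ab Gi]]] := card_edge G i.
  have := noW a; have := noW b; rewrite Gi !inE !eqxx orbT /= !andbT.
  by move/eqP => <- /eqP eab; rewrite eab eqxx in ab.
by rewrite iM vi.
Qed.

Lemma partnerK M : matching M -> involutive (partner M).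
Proof.
move=> mM v; have [/partner_missed e|/forall_inPn[i iM /negPn vi]] := boolP (missed M v).
  by rewrite !e.
have := partner_edge mM iM vi; set w := partner M v => /setD1P[wv wi].
have /setD1P[xw xi] := partner_edge mM iM wi.
by have [] := edge_endpoints vi wi _ xi; rewrite 1?eq_sym // => /eqP; rewrite (negPf xw).
Qed.

End Matchings.

(** * Orbits under a product of two involutions *)

Section InvolutionOrbits.
Local Open Scope group_scope.
Variables (T : finType) (m s : {perm T}) (t : T).
Hypotheses (mK : m * m = 1) (sK : s * s = 1) (st : s t = t).
Let p := s * m.

(** [s] conjugates [p] to its inverse and fixes [t]. *)
Let s_pX k : s ((p ^+ k) t) = (p ^- k) t.
Proof.
have sV : s^-1 = s by apply/eqP; rewrite eq_invg_mul sK.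
have mV : m^-1 = m by apply/eqP; rewrite eq_invg_mul mK.
have ps : p ^ s = p^-1 by rewrite /conjg /p invMg sV mV !mulgA sK mul1g.
by rewrite -permM conjgC conjXg ps expgVn permM st.
Qed.

Let m_ps x : m x = p (s x).
Proof. by rewrite /p -permM mulgA sK mul1g. Qed.

(** [s] reflects the orbit about [t], and [m] is this reflection followed by [p]. *)
Lemma porbit_stable x : x \in porbit p t -> (m x \in porbit p t) && (s x \in porbit p t).
Proof.
move=> /porbitP[k ->]; rewrite m_ps s_pX -expgVn.
have: (p^-1 ^+ k) t \in porbit p t by rewrite -porbitV mem_porbit.
move=> pk; rewrite pk andbT; case/porbitP: pk => i ->.
by apply/porbitP; exists i.+1; rewrite expgSr [RHS]permM.
Qed.

(* On the orbit, [m] maps [p^a t] to [p^(1-a) t], so [p^a t] is fixed by [m] iff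
   [p^(2a) t = p t]; iterating [b] times gives [p^(2ab) t = p^b t]. *)
Lemma porbit_fixpoint_unique u v : m u = u -> m v = v ->
  u \in porbit p t -> v \in porbit p t -> u = v.
Proof.
have double a : m ((p ^+ a) t) = (p ^+ a) t -> (p ^+ (2 * a)) t = p t.
  rewrite m_ps s_pX => e; rewrite mul2n -addnn expgD permM -e.
  by rewrite -!permM -expgS expgSr mulKg.
have iterate a k : m ((p ^+ a) t) = (p ^+ a) t -> (p ^+ (k * (2 * a))) t = (p ^+ k) t.
  move=> /double pa; elim: k => // k IHk.
  by rewrite mulSn expgD permM pa -permM -expgS expgSr permM IHk -permM -expgSr.
move=> mu mv /porbitP[a ua] /porbitP[b vb].
rewrite ua in mu; rewrite vb in mv.
by rewrite ua vb -(iterate b) // -(iterate a b) // !mulnA; congr ((p ^+ _) t); lia.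
Qed.

End InvolutionOrbits.

(** * The matching polyhedron *)

Section LinearForms.
Variables (R : realType) (n : nat).
Implicit Types (x y u v c : 'rV[R]_n).

Lemma linear_formC x y : linear_form x y = linear_form y x.
Proof. by apply: eq_bigr => i _; rewrite mulrC. Qed.

Lemma linear_formDr c x y : linear_form c (x + y) = linear_form c x + linear_form c y.
Proof. by rewrite -big_split; apply: eq_bigr => i _; rewrite mxE mulrDr. Qed.

Lemma linear_formZr c a x : linear_form c (a *: x) = a * linear_form c x.
Proof. by rewrite mulr_sumr; apply: eq_bigr => i _; rewrite mxE mulrCA. Qed.

Lemma linear_formNr c x : linear_form c (- x) = - linear_form c x.
Proof. by rewrite -scaleN1r linear_formZr mulN1r. Qed.

Lemma linear_formBr c x y : linear_form c (x - y) = linear_form c x - linear_form c y.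
Proof. by rewrite linear_formDr linear_formNr. Qed.

Lemma linear_formDl x y u : linear_form (x + y) u = linear_form x u + linear_form y u.
Proof. by rewrite !(linear_formC _ u) linear_formDr. Qed.

Lemma linear_formZl a x u : linear_form (a *: x) u = a * linear_form x u.
Proof. by rewrite !(linear_formC _ u) linear_formZr. Qed.

Lemma linear_formBl x y u : linear_form (x - y) u = linear_form x u - linear_form y u.
Proof. by rewrite !(linear_formC _ u) linear_formBr. Qed.

Lemma linear_form_sumr c I (s : seq I) (P : pred I) (F : I -> 'rV[R]_n) :
  linear_form c (\sum_(i <- s | P i) F i) = \sum_(i <- s | P i) linear_form c (F i).
Proof.
elim/big_rec2: _ => [|i y z _ <-]; last by rewrite linear_formDr.
by rewrite /linear_form big1 // => i _; rewrite mxE mulr0.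
Qed.

Lemma linear_form_delta c i : linear_form c (delta_mx 0 i) = c 0 i.
Proof.
rewrite /linear_form (bigD1 i) //= big1 => [|j /negPf nji].
  by rewrite mxE !eqxx mulr1 addr0.
by rewrite mxE nji andbF mulr0.
Qed.

Lemma linear_formE (phi : {linear 'rV[R]_n -> R^o}) :
  exists alpha, forall x, phi x = linear_form alpha x.
Proof.
exists (\row_i phi (delta_mx 0 i)) => x.
rewrite {1}(row_sum_delta x) linear_sum; apply: eq_bigr => i _.
by rewrite linearZ mxE mulrC.
Qed.

End LinearForms.

(** * Exchange of matchings along an alternating component *)

Section MatchingExchange.
Variables (V : finType) (n : nat) (G : numbered_graph V n).
Implicit Types (M N K : {set 'I_n}) (u v t : V).

(* The alternating component of [t] in the union of [M] and [N] is the orbit of [t]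
   under the composite of the two partner involutions; it contains at most one vertex
   missed by [M]. *)
Lemma matching_exchange M N u v t : matching G M -> matching G N ->
  missed G M u -> missed G M v -> u != v -> missed G N t ->
  exists2 K, separated G K (M :|: N) &
    missed G (swap K M N) t /\ (missed G (swap K M N) u \/ missed G (swap K M N) v).
Proof.
move=> mM mN Mu Mv uv Nt.
pose m := perm (inv_inj (partnerK mM)); pose s := perm (inv_inj (partnerK mN)).
have mK : (m * m = 1)%g by apply/permP => x; rewrite permM !permE partnerK // perm1.
have sK : (s * s = 1)%g by apply/permP => x; rewrite permM !permE partnerK // perm1.
have st : s t = t by rewrite permE partner_missed.
pose O := porbit (s * m)%g t.
(* The other endpoint of an edge of [M] or [N] is the image of the first under a partner involution,
   so an edge meeting the orbit lies inside it. *)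
have subO i x : i \in M :|: N -> x \in G i -> x \in O -> G i \subset O.
  move=> iMN xi xO; have /andP[mO sO] := porbit_stable mK sK st xO.
  apply/subsetP => y yi; have [-> //|nyx] := eqVneq y x.
  case/setUP: iMN => [iM|iN].
    have /setD1P[px pi] := partner_edge mM iM xi.
    have [y_p|y_x] := edge_endpoints pi xi px yi; last by rewrite y_x eqxx in nyx.
    by rewrite y_p; rewrite permE in mO.
  have /setD1P[px pi] := partner_edge mN iN xi.
  have [y_p|y_x] := edge_endpoints pi xi px yi; last by rewrite y_x eqxx in nyx.
  by rewrite y_p; rewrite permE in sO.
have tO : t \in O by exact: porbit_id.
exists [set i | G i \subset O].
  move=> i j x iMN jMN; rewrite !inE => /subsetP iO xi xj.
  by apply: (subO j x) => //; apply: iO.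
have missO x : x \notin O -> missed G M x -> missed G (swap [set i | G i \subset O] M N) x.
  move=> xO Mx; apply/forall_inP => i; rewrite !inE => /orP[/andP[_ iM]|/andP[_ /subsetP iO]].
    by rewrite (missed_out Mx iM).
  by apply: contra xO; apply: iO.
split.
  apply/forall_inP => i; rewrite !inE => /orP[/andP[iO iM]|/andP[iN _]].
    by apply: contra iO => ti; apply: (subO i t); rewrite ?inE ?iM.
  by rewrite (missed_out Nt iN).
have [uO|uO] := boolP (u \in O); last by left; apply: missO.
have [vO|vO] := boolP (v \in O); last by right; apply: missO.
have fixm x : missed G M x -> m x = x by move=> ?; rewrite permE partner_missed.
have e := porbit_fixpoint_unique mK sK st (fixm _ Mu) (fixm _ Mv) uO vO.
by rewrite e eqxx in uv.
Qed.

End MatchingExchange.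

Section Indicator.
Variables (R : realType) (n : nat).
Implicit Types (M N K : {set 'I_n}) (c x : 'rV[R]_n).

Definition indicator M : 'rV[R]_n := \row_i (i \in M)%:R.

Lemma linear_form_indicator c M : linear_form c (indicator M) = \sum_(i in M) c 0 i.
Proof.
rewrite /linear_form [RHS]big_mkcond; apply: eq_bigr => i _.
by rewrite mxE; case: (i \in M); rewrite ?mulr1 ?mulr0.
Qed.

Lemma sum_indicator (P : pred 'I_n) M :
  \sum_(i < n | P i) indicator M 0 i = #|[set i in M | P i]|%:R.
Proof.
rewrite -sum1_card natr_sum big_mkcond [RHS]big_mkcond; apply: eq_bigr => i _.
by rewrite mxE inE; case: (i \in M); case: (P i).
Qed.

Lemma linear_form_pred (P : pred 'I_n) x :
  linear_form (\row_i (P i)%:R) x = \sum_(i < n | P i) x 0 i.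
Proof.
rewrite /linear_form [RHS]big_mkcond; apply: eq_bigr => i _.
by rewrite mxE; case: (P i); rewrite ?mul1r ?mul0r.
Qed.

Lemma indicator_swap K M N :
  indicator (swap K M N) + indicator (swap K N M) = indicator M + indicator N.
Proof.
apply/rowP => i; rewrite !mxE !inE.
by case: (i \in K); case: (i \in M); case: (i \in N); rewrite /= ?addr0 ?add0r.
Qed.

End Indicator.
Arguments indicator R {n} M.

(** * Optimal matchings and tight inequalities *)

Section OptimalMatchings.
Variables (R : realType) (V : finType) (n : nat) (G : numbered_graph V n).
Implicit Types (M N K : {set 'I_n}) (c : 'rV[R]_n) (S : {set V}) (u v : V).

Lemma indicator_in_polyhedron M : matching G M -> matching_polyhedron R G (indicator R M).
Proof.
move=> mM; split=> [i|v|S k Sk].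
- by rewrite mxE ler0n.
- by rewrite (sum_indicator R (fun i => v \in G i)) lern1 degree_le1.
- rewrite (sum_indicator R (fun i => G i \subset S)) ler_nat.
  by have := card_edges_inside S mM; rewrite Sk; lia.
Qed.

Definition optimal c M := matching G M &&
  [forall N, matching G N ==>
    (linear_form c (indicator R N) <= linear_form c (indicator R M))].

Lemma optimalP c M : reflect (matching G M /\ forall N, matching G N ->
    linear_form c (indicator R N) <= linear_form c (indicator R M)) (optimal c M).
Proof.
apply: (iffP andP) => -[mM h]; split=> //.
  by move=> N mN; have /forallP/(_ N)/implyP := h; apply.
by apply/forallP => N; apply/implyP/h.
Qed.

Lemma optimal_exists c : exists M, optimal c M.
Proof.
pose F M := linear_form c (indicator R M).
have [M mM h] := @arg_maxP _ R _ set0 (matching G) F (matching0 G).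
by exists M; apply/optimalP; split=> // N /h.
Qed.

Section PositivePart.
Variable c : 'rV[R]_n.

(** With positive edges only, every edge of the matching lies inside a component of the
    positive-weight graph. *)
Definition positive_optimal M := optimal c M && (M \subset [set i | 0 < c 0 i]).

Definition positive_adjacent u v :=
  [exists i, [&& 0 < c 0 i, u \in G i, v \in G i & u != v]].

Lemma optimal_positive_part M : optimal c M ->
  positive_optimal (M :&: [set i | 0 < c 0 i]).
Proof.
move=> /optimalP[mM oM]; rewrite /positive_optimal subsetIr andbT.
apply/optimalP; split; first exact: matching_sub (subsetIl _ _) mM.
move=> N /oM /le_trans; apply; rewrite !linear_form_indicator.
rewrite (big_setID [set i | 0 < c 0 i]) /= gerDl sumr_le0 // => i.
by rewrite !inE -leNgt => /andP[].
Qed.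

(** Otherwise an edge of positive weight between [u] and [v] could be added to [M]. *)
Lemma positive_adjacent_missed M u v : positive_optimal M -> positive_adjacent u v ->
  missed G M u -> missed G M v -> False.
Proof.
move=> /andP[/optimalP[/matchingP mM oM] _] /existsP[i /and4P[ci ui vi uv]] Mu Mv.
have iM : i \notin M by apply/negP => iM; rewrite (missed_out Mu iM) in ui.
have far j w : j \in M -> w \in G i -> w \in G j = false.
  by move=> jM /(edge_endpoints ui vi uv)[] ->; rewrite (missed_out _ jM).
suff /oM : matching G (i |: M).
  by rewrite !linear_form_indicator big_setU1 //= gerDr leNgt ci.
apply/matchingP => w j k /setU1P[->|jM] /setU1P[->|kM] //.
- by move=> wi; rewrite (far k w).
- by move=> wj wi; rewrite (far j w) in wj.
- exact: mM.
Qed.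

(** The two swaps have the same total weight as [M] and [N], so neither can fall below the
    optimum. *)
Lemma positive_optimal_swap K M N : separated G K (M :|: N) ->
  positive_optimal M -> positive_optimal N -> positive_optimal (swap K M N).
Proof.
move=> sK /andP[/optimalP[mM oM] /subsetP Mc] /andP[/optimalP[mN oN] /subsetP Nc].
have mMN := matching_swap sK mM mN.
rewrite setUC in sK; have mNM := matching_swap sK mN mM.
apply/andP; split; last first.
  by apply/subsetP => i /setUP[/setDP[/Mc]|/setIP[/Nc]].
apply/optimalP; split=> // L mL.
have := congr1 (linear_form c) (indicator_swap R K M N); rewrite !linear_formDr.
by have := oM _ mL; have := oN _ mM; have := oN _ mNM; lra.
Qed.

(** Induction along the path. Exchanging [M] with a matching that misses the next vertex [t] gives
    one that misses [t] and either [u], impossible for neighbours, or the far end. In the latter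
    case the induction hypothesis makes [t] the far end, so [M] misses the neighbours [u] and
    [t]. *)
Lemma positive_path_missed M u p : path positive_adjacent u p ->
  (forall x, x \in p -> exists2 N, positive_optimal N & missed G N x) ->
  positive_optimal M -> missed G M u -> missed G M (last u p) -> u = last u p.
Proof.
elim: p u M => // t p IHp u M /= /andP[ut tp] crit oM Mu Mv.
apply/eqP; apply: contraT => uv.
have [N oN Nt] := crit t (mem_head _ _).
have [mM mN] : matching G M /\ matching G N.
  by move: oM oN => /andP[/andP[-> _] _] /andP[/andP[-> _] _].
have [K sK [t' [u'|v']]] := matching_exchange mM mN Mu Mv uv Nt.
  by have := positive_adjacent_missed (positive_optimal_swap sK oM oN) ut u' t'.
have tv : t = last t p.
  apply: IHp (positive_optimal_swap sK oM oN) t' v' => // x xp.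
  by apply: crit; rewrite inE xp orbT.
by case: (positive_adjacent_missed oM ut Mu); rewrite tv.
Qed.

End PositivePart.

(* Lovasz: if each vertex of a component [S] of the positive-weight graph is missed by some
   optimal matching, then the optimal matchings using only positive edges miss exactly one
   vertex of [S], so the odd-set inequality of [S] is tight. *)
Lemma tight_constraint c i0 : c 0 i0 != 0 ->
  exists (a : 'rV[R]_n) (b : R),
  [/\ forall x, matching_polyhedron R G x -> linear_form a x <= b,
      forall M, optimal c M -> linear_form a (indicator R M) = b
    & exists2 M, matching G M & linear_form a (indicator R M) < b].
Proof.
move=> ci0.
have lf0 a : linear_form a (indicator R (set0 : {set 'I_n})) = 0.
  by rewrite linear_form_indicator big_set0.
(* If some weight is negative, optimal matchings avoid that edge and its nonnegativity constraint is
   tight. *)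
have [/existsP[i ci]|c_ge0] := boolP [exists i, c 0 i < 0].
  exists (- delta_mx 0 i), 0.
  have lfE x : linear_form (- delta_mx 0 i) x = - x 0 i.
    by rewrite linear_formC linear_formNr linear_form_delta.
  split=> [x [x0 _ _]|M /optimalP[mM oM]|]; rewrite ?lfE.
  - by rewrite oppr_le0.
  - rewrite mxE; have [iM|] := boolP (i \in M); last by rewrite oppr0.
    have /oM : matching G (M :\ i) by exact: matching_sub (subsetDl _ _) mM.
    by rewrite !linear_form_indicator [leRHS](big_setD1 i) //= lerDr leNgt ci.
  - exists [set i]; first exact: matching1.
    by rewrite lfE mxE set11 oppr_lt0 ltr01.
have {}c_ge0 i : 0 <= c 0 i.
  by rewrite leNgt; apply: contra c_ge0 => ci; apply/existsP; exists i.
have {}ci0 : 0 < c 0 i0 by rewrite lt_def ci0 c_ge0.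
have /eqP/cards2P[v0 [v1 [v01 Gi0]]] := card_edge G i0.
pose adj := positive_adjacent c.
have sym_adj : connect_sym adj.
  apply: sym_connect_sym => x y; apply: eq_existsb => i.
  by rewrite eq_sym (andbCA (x \in G i)).
pose S := [set v | connect adj v0 v].
(* A vertex of [S] covered by every optimal matching makes its degree inequality tight. *)
have [/exists_inP[v vS /forallP cov]|crit] :=
  boolP [exists v in S, forall M, optimal c M ==> ~~ missed G M v].
  exists (\row_i (v \in G i)%:R), 1.
  split=> [x [_ x1 _]|M oM|]; rewrite ?(linear_form_pred (fun i => v \in G i)) //.
  - rewrite (sum_indicator R (fun i => v \in G i)).
    have /implyP/(_ oM)/forall_inPn[i iM /negPn vi] := cov M.
    have /optimalP[mM _] := oM.
    have := degree_le1 v mM; rewrite leq_eqVlt => /orP[/eqP -> //|].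
    rewrite ltnS leqn0 cards_eq0 => /eqP/setP/(_ i).
    by rewrite !inE iM vi.
  - by exists set0; [exact: matching0|rewrite lf0 ltr01].
have {}crit v : v \in S -> exists2 N, positive_optimal c N & missed G N v.
  move=> vS; have := crit; rewrite negb_exists => /forallP/(_ v).
  rewrite vS negb_forall => /existsP[N]; rewrite negb_imply negbK => /andP[oN Nv].
  exists (N :&: [set i | 0 < c 0 i]); first exact: optimal_positive_part.
  by apply/forall_inP => i /setIP[iN _]; rewrite (missed_out Nv iN).
have one M u v : positive_optimal c M -> u \in S -> v \in S ->
    missed G M u -> missed G M v -> u = v.
  move=> oM uS vS Mu Mv.
  have /connectP[p up pv] : connect adj u v.
    by move: uS vS; rewrite !inE [connect adj v0 u]sym_adj; apply: connect_trans.
  rewrite pv; apply: (positive_path_missed up _ oM Mu); rewrite -?pv // => x xp.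
  apply: crit; move: uS; rewrite !inE => /connect_trans; apply.
  by have := path_connect up; apply; rewrite inE xp orbT.
have insideS i x : 0 < c 0 i -> x \in G i -> x \in S -> G i \subset S.
  move=> ci xi; rewrite inE => xS; apply/subsetP => y yi; rewrite inE.
  have [<- //|xy] := eqVneq x y; apply: connect_trans xS (connect1 _).
  by apply/existsP; exists i; rewrite ci xi yi xy.
have v0S : v0 \in S by rewrite inE connect0.
have i0S : G i0 \subset S by apply: (insideS i0 v0); rewrite ?Gi0 ?inE ?eqxx.
pose q M := #|[set i in M | G i \subset S]|.
(* An edge of positive weight meeting [S] lies inside [S], so the covered vertices of [S] are
   matched within [S]. *)
have countS M : positive_optimal c M ->
    (#|S| = 2 * q M + #|[set v in S | missed G M v]|)%N.
  move=> /andP[/optimalP[mM _] /subsetP Mc].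
  have <- : (\sum_(v in S) #|[set i in M | v \in G i]| = 2 * q M)%N.
    rewrite sum_degree mulnC -sum_nat_const [LHS](bigID (fun i => G i \subset S)) /=.
    rewrite [X in (_ + X)%N]big1 ?addn0 => [|i /andP[iM iS]].
      apply: eq_big => [i|i /andP[_ /setIidPl ->]]; first by rewrite inE.
      by rewrite card_edge.
    apply/eqP; rewrite cards_eq0; apply: contraNT iS => /set0Pn[x /setIP[xi xS]].
    by apply: insideS xS => //; have := Mc i iM; rewrite inE.
  rewrite -sum1_card -[X in (_ + X)%N]sum1_card [X in (_ + X)%N]big_mkcond /=.
  rewrite [X in (_ + X)%N](eq_bigr (fun v => if v \in S then nat_of_bool (missed G M v) else 0%N)).
    rewrite -big_mkcond -big_split; apply: eq_bigr => v vS /=.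
    have [Mv|/forall_inPn[i iM /negPn vi]] := boolP (missed G M v).
      rewrite (_ : [set _ in _ | _] = set0) ?cards0 //; apply/setP => i.
      by rewrite !inE; case: (boolP (i \in M)) => //= /(missed_out Mv) ->.
    have := degree_le1 v mM; rewrite addn0 leq_eqVlt => /orP[/eqP -> //|].
    rewrite ltnS leqn0 cards_eq0 => /eqP/setP/(_ i).
    by rewrite !inE iM vi.
  by move=> v _; rewrite inE; case: (v \in S); case: (missed G M v).
have missle1 M : positive_optimal c M -> (#|[set v in S | missed G M v]| <= 1)%N.
  move=> oM; apply/card_le1_eqP => u v; rewrite !inE => /andP[uS Mu] /andP[vS Mv].
  by apply: (one M) => //; rewrite inE.
have [N oN Nv0] := crit v0 v0S.
have Sodd : #|S| = (q N).*2.+1.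
  have missN : (0 < #|[set v in S | missed G N v]|)%N.
    by apply/card_gt0P; exists v0; rewrite inE v0S.
  by have := countS _ oN; have := missle1 _ oN; lia.
exists (\row_i (G i \subset S)%:R), (q N)%:R.
split=> [x [_ _ xS]|M oM|]; rewrite ?(linear_form_pred (fun i => G i \subset S)).
- exact: xS.
- rewrite (sum_indicator R (fun i => G i \subset S)).
  (* The positive part of [M] misses at most one vertex of the odd set [S], so it already has [q N]
     edges inside, and no matching has more. *)
  congr (_%:R); apply/eqP; rewrite eqn_leq.
  have /optimalP[mM _] := oM; have := card_edges_inside S mM.
  have oM' := optimal_positive_part oM.
  have := countS _ oM'; have := missle1 _ oM'.
  set M' := M :&: _ in oM' *.
  have : (q M' <= q M)%N.
    apply: subset_leq_card; apply/subsetP => i.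
    by rewrite !inE => /andP[/andP[-> _] ->].
  by rewrite -/(q M); lia.
(* [S] contains both ends of [i0], so the bound is positive and the empty matching stays strictly
   below it. *)
- exists set0; first exact: matching0.
  have := subset_leq_card i0S; rewrite card_edge.
  by rewrite lf0 ltr0n Sodd; lia.
Qed.

(* Subtract from [c] the largest multiple of a tight constraint that keeps the optimal
   matchings optimal: at least one more matching then becomes optimal. *)
Lemma optimal_bounds_polyhedron c M x : optimal c M -> matching_polyhedron R G x ->
  linear_form c x <= linear_form c (indicator R M).
Proof.
(* Induction on the number of matchings that are not optimal. *)
move=> oM Px; have [k] := ubnP #|[set N | matching G N && ~~ optimal c N]|.
elim: k c M oM => // k IHk c M oM; rewrite ltnS => le_k.
have [/existsP[i0 /(@tight_constraint c i0)[a [b [ab tight [M0 mM0 aM0]]]]]|] :=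
    boolP [exists i, c 0 i != 0]; last first.
  rewrite negb_exists => /forallP c0.
  have c00 i : c 0 i = 0 by apply/eqP; have := c0 i; rewrite negbK.
  rewrite linear_form_indicator /linear_form !big1 // => i _; rewrite c00 ?mul0r //.
pose A N := linear_form a (indicator R N); pose C N := linear_form c (indicator R N).
(* For [L] not tight, subtracting [l *: a] keeps [L] no better than [M] exactly when [l] is at most
   [ratio L]; hence the minimum below. *)
pose ratio N := (C M - C N) / (b - A N).
pose P N := matching G N && (A N < b).
have P0 : P M0 by rewrite /P mM0.
have [N /andP[mN aN] minN] := @arg_minP _ R _ M0 P ratio P0.
pose l := ratio N; pose c' := c - l *: a.
have c'E y : linear_form c' y = linear_form c y - l * linear_form a y.
  by rewrite linear_formBl linear_formZl.
have CM L : matching G L -> C L <= C M by have /optimalP[_] := oM; apply.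
have l0 : 0 <= l by apply: divr_ge0; rewrite subr_ge0 ?CM // ltW.
have AM : A M = b by apply: tight.
have lN : l * (b - A N) = C M - C N.
  by rewrite /l /ratio divfK // subr_eq0 gt_eqF.
have bound L : matching G L -> linear_form c' (indicator R L) <= C M - l * b.
  move=> mL; rewrite c'E -/(C L) -/(A L).
  have : A L <= b by apply: ab; apply: indicator_in_polyhedron.
  rewrite le_eqVlt => /orP[/eqP ->|aL]; first by rewrite lerD2r CM.
  have : l <= ratio L by apply: minN; rewrite /P mL.
  by rewrite ler_pdivlMr ?subr_gt0 //; lra.
have opt' L : matching G L -> linear_form c' (indicator R L) = C M - l * b ->
    optimal c' L.
  by move=> mL eL; apply/optimalP; split=> // ? /bound; rewrite eL.
have oldopt L : optimal c L -> optimal c' L.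
  move=> oL; have /optimalP[mL CL] := oL; apply: opt' => //.
  rewrite c'E tight //; congr (_ - _); apply/eqP; rewrite eq_le CM //=.
  by apply: CL; have /optimalP[] := oM.
have mM : matching G M by have /optimalP[] := oM.
have eM : linear_form c' (indicator R M) = C M - l * b.
  by rewrite c'E -/(A M) AM.
have := IHk c' M (oldopt _ oM).
rewrite eM c'E => /(_ _) h.
have {}h : linear_form c x - l * linear_form a x <= C M - l * b.
  (* [N] attains the minimal ratio, so it is optimal for [c']; it is not optimal for [c], since the
     constraint is not tight at [N]. *)
  apply: h; apply: leq_trans _ le_k; apply: proper_card; apply/properP; split.
    apply/subsetP => L; rewrite !inE => /andP[-> ]; apply: contra; exact: oldopt.
  exists N; rewrite !inE mN /=.
    by apply/negP => /tight eN; rewrite -/(A N) in eN; rewrite eN ltxx in aN.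
  rewrite negbK; apply: opt' => //; rewrite c'E -/(A N) -/(C N); lra.
have := ler_wpM2l l0 (ab x Px); rewrite -/(C M); lra.
Qed.

End OptimalMatchings.

(** * Components of a symmetric difference of matchings *)

Local Ltac nat_lia :=
  repeat match goal with H : ?T |- _ =>
    lazymatch T with
    | nat => fail
    | is_true (leq _ _) => fail
    | is_true (andb (leq _ _) (leq _ _)) => fail
    | is_true (negb (@eq_op _ ?x _)) =>
        let A := type of x in tryif unify A nat then fail else clear H
    | is_true (@eq_op _ ?x _) =>
        let A := type of x in tryif unify A nat then fail else clear H
    | (@eq_op _ ?x _) = _ =>
        let A := type of x in tryif unify A nat then fail else clear H
    | @eq ?A _ _ => tryif unify A nat then fail else clear H
    | _ => clear H
    end
  end; lia.

Section AlternatingComponent.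
Variables (V : finType) (n : nat) (G : numbered_graph V n).
Implicit Types (s : seq 'I_n) (i j e f : 'I_n).

Definition share i j := [exists v, (v \in G i) && (v \in G j)].

Lemma shareP i j : reflect (share_vertex G i j) (share i j).
Proof.
apply: (iffP existsP) => [[v /andP[vi vj]]|[v [vi vj]]]; exists v; first by split.
by rewrite vi vj.
Qed.

Lemma shareC i j : share i j = share j i.
Proof. by apply: eq_existsb => v; rewrite andbC. Qed.

(** Induced path in the line graph; [i0] is the default value of [nth]. *)
Definition induced_path i0 s := forall a b, (a < b < size s)%N ->
  share (nth i0 s a) (nth i0 s b) = (b == a.+1).

Definition induced_cycle i0 s := forall a b, (a < b < size s)%N ->
  share (nth i0 s a) (nth i0 s b) = (b == a.+1) || (a == 0%N) && (b == (size s).-1).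

Variables M N : {set 'I_n}.
Hypotheses (mM : matching G M) (mN : matching G N).
Local Notation D := ((M :\: N) :|: (N :\: M)).

Lemma symdiff_color e f : e \in D -> f \in D -> share e f -> e != f ->
  (f \in M) = (e \notin M).
Proof.
move=> eD fD /existsP[v /andP[ve vf]] /negPf nef; move: eD fD; rewrite !inE.
case: (boolP (e \in M)) => eM; case: (boolP (f \in M)) => fM //=; rewrite ?andbF ?andbT ?orbF.
  by move/matchingP: mM => /(_ v e f eM fM ve vf) e_f; rewrite e_f eqxx in nef.
move=> eN fN.
by move/matchingP: mN => /(_ v e f eN fN ve vf) e_f; rewrite e_f eqxx in nef.
Qed.

Lemma symdiff_color_inj e f v : e \in D -> f \in D -> (e \in M) = (f \in M) ->
  v \in G e -> v \in G f -> e = f.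
Proof.
move=> eD fD ef ve vf; apply/eqP; apply: contraT => nef.
have := symdiff_color eD fD _ nef; rewrite ef => h.
have /h : share e f by apply/existsP; exists v; rewrite ve vf.
by case: (f \in M).
Qed.

(** Two of the three neighbours meet [e] at the same endpoint; both lie in the matching that does
    not contain [e], so they coincide. *)
Lemma symdiff_degree e f1 f2 f3 : e \in D -> f1 \in D -> f2 \in D -> f3 \in D ->
  share e f1 -> share e f2 -> share e f3 -> e != f1 -> e != f2 -> e != f3 ->
  [|| f1 == f2, f1 == f3 | f2 == f3].
Proof.
move=> eD D1 D2 D3 s1 s2 s3 n1 n2 n3.
have c1 := symdiff_color eD D1 s1 n1; have c2 := symdiff_color eD D2 s2 n2.
have c3 := symdiff_color eD D3 s3 n3.
case/existsP: s1 => v1 /andP[e1 v1f]; case/existsP: s2 => v2 /andP[e2 v2f].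
case/existsP: s3 => v3 /andP[e3 v3f].
have [v12|v12] := eqVneq v1 v2.
  by apply/or3P/Or31/eqP; apply: (@symdiff_color_inj _ _ v1); rewrite ?c1 ?c2 // v12.
have [v31|v32] := edge_endpoints e1 e2 v12 e3.
  by apply/or3P/Or32/eqP; apply: (@symdiff_color_inj _ _ v1); rewrite ?c1 ?c3 // -v31.
by apply/or3P/Or33/eqP; apply: (@symdiff_color_inj _ _ v2); rewrite ?c2 ?c3 // -v32.
Qed.

(** Closure inside the difference suffices: an edge common to [M] and [N] shares no vertex with an
    edge of the difference. *)
Lemma symdiff_separated s : {subset s <= D} ->
  (forall e f, e \in s -> f \in D -> e != f -> share e f -> f \in s) ->
  separated G [set x in s] (M :|: N).
Proof.
move=> sD closed_s i j v iMN jMN; rewrite !inE => is_ vi vj.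
have iD := sD _ is_; have [<- //|nij] := eqVneq i j.
apply: (closed_s i) => //; last by apply/existsP; exists v; rewrite vi vj.
apply: contraT => jD.
have {jD jMN} /andP[jM jN] : (j \in M) && (j \in N).
  by move: jD jMN; rewrite !inE; case: (j \in M); case: (j \in N).
move: iD; rewrite !inE => /orP[/andP[_ iM]|/andP[_ iN]].
  by move/matchingP: mM nij => /(_ v i j iM jM vi vj) ->; rewrite eqxx.
by move/matchingP: mN nij => /(_ v i j iN jN vi vj) ->; rewrite eqxx.
Qed.

Let good i0 s := [/\ s != [::], uniq s, {subset s <= D} & induced_path i0 s].

Let component i0 s := [/\ s != [::], uniq s, {subset s <= D},
  separated G [set x in s] (M :|: N)
  & induced_path i0 s \/ (induced_cycle i0 s /\ ~~ odd (size s))].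

Let good_rev i0 s : good i0 s -> good i0 (rev s).
Proof.
move=> [s0 us sD ps]; split.
- by rewrite -size_eq0 size_rev size_eq0.
- by rewrite rev_uniq.
- by move=> x; rewrite mem_rev; apply: sD.
- move=> a b; rewrite size_rev => /andP[ab bs].
  by rewrite !nth_rev ?(ltn_trans ab) // shareC ps; nat_lia.
Qed.

Let color_nth i0 s : {subset s <= D} -> uniq s ->
  (forall a, (a.+1 < size s)%N -> share (nth i0 s a) (nth i0 s a.+1)) ->
  forall a, (a < size s)%N -> (nth i0 s a \in M) = odd a (+) (nth i0 s 0 \in M).
Proof.
move=> sD us sh; elim=> [|a IHa] as_; first by rewrite addFb.
have as' := ltnW as_.
rewrite (@symdiff_color (nth i0 s a)) ?sh ?sD ?mem_nth ?IHa ?addNb //.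
by rewrite nth_uniq // ltn_eqF.
Qed.

(* An induced path in the line graph of [D] that can be prolonged by an edge [e] either
   stays induced, or [e] closes it into a cycle: an inner edge of the path already has
   its two neighbours. *)
Let good_extend i0 s e : good i0 s -> e \in D -> e \notin s -> share (last i0 s) e ->
  good i0 (rcons s e) \/ component i0 (rcons s e).
Proof.
move=> [s0 us sD ps] eD es se.
have size_gt0 : (0 < size s)%N by rewrite lt0n size_eq0.
have tD : {subset rcons s e <= D}.
  by move=> x; rewrite mem_rcons inE => /predU1P[->|/sD].
have ut : uniq (rcons s e) by rewrite rcons_uniq es.
have t0 : rcons s e != [::] by rewrite -size_eq0 size_rcons.
have nthD a : (a < size s)%N -> nth i0 s a \in D by move=> ?; apply/sD/mem_nth.
have nthe a : (a < size s)%N -> nth i0 s a != e.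
  by move=> as_; apply: contraNneq es => <-; rewrite mem_nth.
have inner a : (0 < a)%N -> (a.+1 < size s)%N -> share (nth i0 s a) e = false.
  move=> a0 as_; apply/negbTE/negP => sh.
  have [a1s as' a1a] : [/\ (a.-1 < size s)%N, (a < size s)%N & a.-1.+1 = a] by split; nat_lia.
  have sh1 : share (nth i0 s a) (nth i0 s a.-1) by rewrite shareC ps a1a ?eqxx; nat_lia.
  have sh2 : share (nth i0 s a) (nth i0 s a.+1) by rewrite ps ?eqxx; nat_lia.
  have na1 : nth i0 s a != nth i0 s a.-1 by rewrite nth_uniq //; nat_lia.
  have na2 : nth i0 s a != nth i0 s a.+1 by rewrite nth_uniq //; nat_lia.
  have := symdiff_degree (nthD _ as') (nthD _ a1s) (nthD _ as_) eD sh1 sh2 sh na1 na2 (nthe _ as').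
  by rewrite (negPf (nthe _ a1s)) (negPf (nthe _ as_)) !orbF nth_uniq //; nat_lia.
have lastE : last i0 s = nth i0 s (size s).-1 by rewrite nth_last.
have nth_t a : (a < size s)%N -> nth i0 (rcons s e) a = nth i0 s a.
  by move=> as_; rewrite nth_rcons as_.
have nth_e : nth i0 (rcons s e) (size s) = e by rewrite nth_rcons ltnn eqxx.
(* For a single edge the first edge is also the last, and [e] prolongs the path instead of closing
   it. *)
have [/andP[sh s2]|noc] := boolP (share (nth i0 s 0) e && (1 < size s)%N); last first.
  left; split=> // a b; rewrite size_rcons ltnS => /andP[ab].
  rewrite leq_eqVlt => /predU1P[bs|bs]; last first.
    by rewrite !nth_t ?ps ?ab // (ltn_trans ab).
  rewrite bs nth_e nth_t -?bs //.
  have [as_|as_] := eqVneq b a.+1; first by rewrite -se lastE -bs as_.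
  case: a ab as_ => [|a] ab as_; last by apply: inner; nat_lia.
  by apply: negbTE; apply: contra noc => ->; nat_lia.
right.
have cyc : induced_cycle i0 (rcons s e).
  move=> a b; rewrite size_rcons ltnS => /andP[ab].
  rewrite leq_eqVlt => /predU1P[bs|bs]; last first.
    rewrite !nth_t ?ps ?ab // ?(ltn_trans ab) //=.
    by rewrite (ltn_eqF bs) andbF orbF.
  rewrite bs nth_e nth_t -?bs //= eqxx andbT.
  have [as_|as_] := eqVneq b a.+1; first by rewrite orTb -se lastE -bs as_.
  case: a ab as_ => [|a] ab as_ //; apply: inner; nat_lia.
split=> //.
(* Every edge of the cycle has its two cyclic neighbours, which leaves no room for a third neighbour
   [f]. *)
- apply: symdiff_separated => // x f xt fD xf shf; apply: contraT => ft.
  have [a as_ ax] : exists2 a, (a < size (rcons s e))%N & nth i0 (rcons s e) a = x.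
    by exists (index x (rcons s e)); rewrite ?index_mem ?nth_index.
  rewrite size_rcons in as_.
  have nthtD b : (b <= size s)%N -> nth i0 (rcons s e) b \in D.
    by move=> bs; apply/tD/mem_nth; rewrite size_rcons.
  have nthtf b : (b <= size s)%N -> (nth i0 (rcons s e) b == f) = false.
    by move=> bs; apply: contraNF ft => /eqP <-; rewrite mem_nth // size_rcons.
  have no b c : (b <= size s)%N -> (c <= size s)%N -> b != c -> b != a -> c != a ->
      share x (nth i0 (rcons s e) b) -> share x (nth i0 (rcons s e) c) -> False.
    move=> bs cs bc ba ca shb shc.
    have nx d : (d <= size s)%N -> d != a -> x != nth i0 (rcons s e) d.
      by move=> ds da; rewrite -ax nth_uniq ?size_rcons // eq_sym.
    have := symdiff_degree (tD _ xt) (nthtD _ bs) (nthtD _ cs) fD shb shc shf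
      (nx _ bs ba) (nx _ cs ca) xf.
    by rewrite !nthtf // nth_uniq ?size_rcons // (negPf bc).
  have shE b c : (b < c <= size s)%N ->
      share (nth i0 (rcons s e) b) (nth i0 (rcons s e) c) =
      (c == b.+1) || (b == 0%N) && (c == size s).
    by move=> bc; rewrite cyc size_rcons.
  case: (no (if a == 0%N then size s else a.-1) (if a == size s then 0%N else a.+1));
    rewrite -?ax; try by do ![case: ifP]; nat_lia.
  + by case: ifP => a0; [rewrite shE|rewrite shareC shE]; nat_lia.
  + by case: ifP => a0; [rewrite shareC shE|rewrite shE]; nat_lia.
- right; split=> //.
  (* Membership in [M] alternates along the sequence and also differs between [e] and the first
     edge, which forces an even length. *)
  have := @color_nth i0 (rcons s e) tD ut.
  have /[swap]/[apply] : forall a, (a.+1 < size (rcons s e))%N ->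
      share (nth i0 (rcons s e) a) (nth i0 (rcons s e) a.+1).
    by move=> a as_; rewrite cyc ?eqxx //; nat_lia.
  move=> /(_ (size s)); rewrite size_rcons ltnSn nth_e nth_t // => /(_ isT).
  rewrite (symdiff_color (nthD _ size_gt0) eD sh (nthe _ size_gt0)).
  by rewrite oddS; case: (odd _); case: (_ \in M).
Qed.

(** An induced path is prolonged at its last edge, or after reversal at its first. Having at most
    [n] edges, it finally closes into a cycle or cannot be prolonged; in the latter case it is a
    component, since its inner edges already have two neighbours. *)
Let component_exists i0 : i0 \in D -> exists s, component i0 s.
Proof.
move=> i0D; suff grow m s : good i0 s -> (n - size s < m)%N -> exists s', component i0 s'.
  apply: (grow n.+1 [:: i0]); last by rewrite /=; nat_lia.
  by split=> // [x|a b]; [rewrite inE => /eqP ->|rewrite /=; nat_lia].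
elim: m s => // m IHm s gs lt_m.
have ext s' e : good i0 s' -> size s' = size s -> e \in D -> e \notin s' ->
    share (last i0 s') e -> exists s'', component i0 s''.
  move=> gs' sz eD es se; have [gt|ct] := good_extend gs' eD es se; last by exists (rcons s' e).
  apply: (IHm _ gt); rewrite size_rcons.
  have : (size (rcons s' e) <= n)%N.
    have [_ ut _ _] := gt; rewrite -[X in (_ <= X)%N](card_ord n) -(card_uniqP ut).
    exact: max_card.
  by rewrite size_rcons; nat_lia.
have [s0 us sD ps] := gs.
have [/existsP[e /and3P[eD es se]]|no_last] :=
  boolP [exists e, [&& e \in D, e \notin s & share (last i0 s) e]].
  exact: ext gs _ eD es se.
have [/existsP[e /and3P[eD es se]]|no_head] :=
  boolP [exists e, [&& e \in D, e \notin s & share (head i0 s) e]].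
  apply: (ext _ e (good_rev gs)); rewrite ?size_rev ?mem_rev //.
  by rewrite -nth_last nth_rev ?size_rev ?prednK ?subnn ?nth0 // lt0n size_eq0.
exists s; split=> //; last by left.
apply: symdiff_separated => // x f xs fD xf shf; apply: contraT => fs.
have size_gt0 : (0 < size s)%N by rewrite lt0n size_eq0.
have [a as_ ax] : exists2 a, (a < size s)%N & nth i0 s a = x.
  by exists (index x s); rewrite ?index_mem ?nth_index.
have [a0|a0] := eqVneq a 0%N.
  case/negP: no_head; apply/existsP; exists f.
  by rewrite fD fs -nth0 -a0 ax.
have [a1|a1] := eqVneq a (size s).-1.
  case/negP: no_last; apply/existsP; exists f.
  by rewrite fD fs -nth_last -a1 ax.
have nthf b : (b < size s)%N -> (nth i0 s b == f) = false.
  by move=> bs; apply: contraNF fs => /eqP <-; rewrite mem_nth.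
have [as1 as2 a1a] : [/\ (a.-1 < size s)%N, (a.+1 < size s)%N & a.-1.+1 = a] by split; nat_lia.
have sh1 : share x (nth i0 s a.-1) by rewrite -ax shareC ps a1a ?eqxx; nat_lia.
have sh2 : share x (nth i0 s a.+1) by rewrite -ax ps ?eqxx; nat_lia.
have n1 : x != nth i0 s a.-1 by rewrite -ax nth_uniq //; nat_lia.
have n2 : x != nth i0 s a.+1 by rewrite -ax nth_uniq //; nat_lia.
have := symdiff_degree (sD _ xs) (sD _ (mem_nth _ as1)) (sD _ (mem_nth _ as2)) fD
  sh1 sh2 shf n1 n2 xf.
by rewrite !nthf // nth_uniq //; nat_lia.
Qed.

(** The last clause, alternation between [M] and [N], identifies the difference of indicators on the
    component with an alternating vector up to sign. *)
Lemma alternating_component : M != N -> exists k (r : 'I_k.+1 -> 'I_n),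
  [/\ simple_path G r \/ (simple_cycle G r /\ ~~ odd k.+1),
      forall j : 'I_k.+1, r j \in D, separated G [set r j | j : 'I_k.+1] (M :|: N)
    & forall j : 'I_k.+1, (r j \in M) = odd j (+) (r ord0 \in M)].
Proof.
move=> nMN.
have [i0 i0D] : exists i0, i0 \in D.
  apply/existsP; apply: contraR nMN; rewrite negb_exists => /forallP noD.
  apply/eqP/setP => i; have := noD i; rewrite !inE.
  by case: (i \in M); case: (i \in N).
have [s [s0 us sD sepS ps]] := component_exists i0D.
have size_gt0 : (0 < size s)%N by rewrite lt0n size_eq0.
pose k := (size s).-1; have sk : size s = k.+1 by rewrite prednK.
have ks (a : 'I_k.+1) : (a < size s)%N by rewrite sk.
pose r (j : 'I_k.+1) := nth i0 s j.
have r_inj : injective r.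
  by move=> a b /eqP; rewrite nth_uniq ?ks // => /eqP/val_inj.
have next a : (a.+1 < size s)%N -> share (nth i0 s a) (nth i0 s a.+1).
  by move=> as_; case: ps => [|[]] ps; rewrite ps ?eqxx //; nat_lia.
exists k, r; split.
- have pr : is_path G r.
    move=> a b ab; apply/shareP; rewrite /r ab; apply: next.
    by rewrite -ab.
  case: ps => [ps|[ps ev]]; [left|right].
    split=> // a b ab /shareP; rewrite /r ps ?ab ?ks // => /eqP //.
  rewrite -sk; split=> //; split=> //.
    split=> //; apply/shareP; rewrite shareC /r ps //=; first by rewrite eqxx orbT.
    (* An even length is at least 2, so the closing pair consists of distinct positions. *)
    by rewrite sk ltnSn andbT; move: ev; rewrite sk; case: (k).
  move=> a b ab /shareP; rewrite /r ps ?ab ?ks // => /orP[/eqP|/andP[/eqP a0 /eqP bk]].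
    by left.
  by right; split; apply: val_inj.
- by move=> j; apply/sD/mem_nth.
- rewrite (_ : [set r j | j : 'I_k.+1] = [set x in s]) //.
  apply/setP => x; rewrite inE; apply/imsetP/idP => [[j _ ->]|xs].
    by rewrite mem_nth.
  have xk : (index x s < k.+1)%N by rewrite -sk index_mem.
  by exists (Ordinal xk); rewrite // /r nth_index.
- by move=> j; apply: color_nth.
Qed.

End AlternatingComponent.

From mathcomp Require Import boolp classical_sets functions topology normedtype.

Import numFieldNormedType.Exports.

Local Open Scope classical_set_scope.

(** * Sign vectors and connected components *)

Section GenericVectors.
Variables (R : realType) (n : nat).
Implicit Types (x y u : 'rV[R]_n).

Lemma linear_form_continuous u : continuous (fun x => linear_form x u).
Proof.
apply: continuous_big => [|i _ x]; first exact: add_continuous.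
exact: (cvgMr_tmp (@coord_continuous R 1 n 0 i x)).
Qed.

Lemma segment_path_continuous x y : continuous (fun t : R => (1 - t) *: x + t *: y).
Proof.
move=> t A [B nB BA]; rewrite nbhs_simpl.
pose f i j (s : R) := (1 - s) * x i j + s * y i j.
have fE s i j : ((1 - s) *: x + s *: y) i j = f i j s by rewrite !mxE.
have cf i j : continuous (f i j).
  move=> s; apply: cvgD; apply: cvgMr_tmp; last exact: cvg_id.
  by apply: cvgB; [exact: cvg_cst|exact: cvg_id].
have nf i j : nbhs t [set s | B i j (f i j s)].
  by apply: cf; have := nB i j; rewrite fE.
apply: (@filterS _ (nbhs t) _ [set s | forall i j, B i j (f i j s)]).
  by move=> s Bs; apply: BA => i j; rewrite fE; apply: Bs.
exact: filter_forall (fun i => filter_forall _ (nf i)).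
Qed.

Definition generic (D : set 'rV[R]_n) : set 'rV[R]_n :=
  [set x | forall d, D d -> linear_form x d <> 0].

(** A form without zeros on a connected set keeps its sign, by the intermediate value property.
    Conversely, a segment joining two generic points with equal signs meets none of the
    hyperplanes. *)
Lemma connected_component_generic (D : set 'rV[R]_n) x : generic D x ->
  connected_component (generic D) x =
  [set y | generic D y /\
     forall d, D d -> (0 < linear_form y d) = (0 < linear_form x d)].
Proof.
move=> gx; apply/seteqP; split => y /=.
  move=> cy; split; first exact: connected_component_sub cy.
  move=> d Dd; set C := connected_component (generic D) x in cy.
  have Cx : C x by exact: connected_component_refl.
  have itvC : is_interval ((fun z => linear_form z d) @` C).
    apply/connected_intervalP; apply: connected_continuous_connected.
      exact: component_connected.
    by apply: continuous_subspaceT; exact: linear_form_continuous.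
  have n0 z : C z -> linear_form z d <> 0.
    by move=> /connected_component_sub; apply.
  have no a b : C a -> C b -> 0 < linear_form a d -> 0 < linear_form b d.
    move=> Ca Cb a0; rewrite ltNge; apply/negP => b0.
    have [z Cz z0] : ((fun z => linear_form z d) @` C) 0.
      apply: (itvC (linear_form b d) (linear_form a d)); [by exists b|by exists a|].
      by rewrite b0 ltW.
    exact: (n0 z Cz).
  by apply/idP/idP; apply: no.
move=> [gy sxy].
pose f (t : R) := (1 - t) *: x + t *: y.
have : connected (f @` `[0, 1]%classic).
  apply: connected_continuous_connected; first exact: segment_connected.
  by apply: continuous_subspaceT; exact: segment_path_continuous.
move=> cf; apply: (connected_component_max _ _ cf).
- by exists 0; rewrite /= ?in_itv /= ?lexx ?ler01 // /f subr0 scale1r scale0r addr0.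
- move=> _ [t + <-] d Dd; rewrite /= in_itv /= => /andP[t0 t1].
  have := sxy _ Dd; have := gx _ Dd; have := gy _ Dd.
  rewrite /f linear_formDl !linear_formZl.
  move: (linear_form x d) (linear_form y d) => a b /eqP b0 /eqP a0.
  by case: (ltrgt0P a) a0 => // a0 _; case: (ltrgt0P b) b0 => // {}b0 _ // _;
    nra.
- by exists 1; rewrite /= ?in_itv /= ?lexx ?ler01 // /f subrr scale1r scale0r add0r.
Qed.

End GenericVectors.

(** * Edges of the matching polyhedron *)

Section MatchingAdjacency.
Variables (R : realType) (V : finType) (n : nat) (G : numbered_graph V n).
Implicit Types (M N K : {set 'I_n}) (x u v : 'rV[R]_n).
Local Notation P := (matching_polyhedron R G).

(** The normal vector of [alternating_hyperplane r]. *)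
Definition alternating_vector k (r : 'I_k.+1 -> 'I_n) : 'rV[R]_n :=
  \sum_(j < k.+1) (-1) ^+ j *: delta_mx 0 (r j).

Lemma linear_form_alternating x k (r : 'I_k.+1 -> 'I_n) :
  linear_form x (alternating_vector r) = \sum_(j < k.+1) (-1) ^+ j * x 0 (r j).
Proof.
rewrite linear_form_sumr; apply: eq_bigr => j _.
by rewrite linear_formZr linear_form_delta.
Qed.

Lemma alternating_vectorE k (r : 'I_k.+1 -> 'I_n) j : injective r ->
  alternating_vector r 0 (r j) = (-1) ^+ j.
Proof.
move=> r_inj; rewrite summxE (bigD1 j) //= big1 => [|i nij].
  by rewrite !mxE !eqxx mulr1 addr0.
by rewrite !mxE (inj_eq r_inj) [j == i]eq_sym (negPf nij) andbF mulr0.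
Qed.

Lemma alternating_vector_out k (r : 'I_k.+1 -> 'I_n) i : (forall j, r j != i) ->
  alternating_vector r 0 i = 0.
Proof.
move=> ri; rewrite summxE big1 // => j _.
by rewrite !mxE [i == r j]eq_sym (negPf (ri j)) andbF mulr0.
Qed.

(** A vertex is the only maximiser of some linear form, and by [optimal_bounds_polyhedron] the
    maximum is attained at a matching. *)
Lemma vertex_matching u : is_vertex P u -> exists2 M, matching G M & u = indicator R M.
Proof.
move=> [c [b [cb eu]]].
have [Pu cu] : (P `&` [set x | linear_form c x = b]) u by rewrite -eu.
have [M oM] := optimal_exists G c; have /optimalP[mM _] := oM.
have PM := indicator_in_polyhedron R mM.
exists M => //; suff : [set u] (indicator R M) by move=> ->.
rewrite eu; split=> //=; apply/eqP; rewrite eq_le cb //= -cu.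
exact: optimal_bounds_polyhedron oM Pu.
Qed.

Lemma polyhedron_pair_le1 x i j w : P x -> w \in G i -> w \in G j -> i != j ->
  x 0 i + x 0 j <= 1.
Proof.
move=> [x0 xv _] wi wj nij; apply: le_trans (xv w).
rewrite (bigD1 i) //= lerD2l (bigD1 j) /=; last by rewrite wj eq_sym.
by rewrite lerDl; apply: sumr_ge0 => *.
Qed.

Lemma polyhedron_le1 x i : P x -> x 0 i <= 1.
Proof.
move=> [x0 xv _]; have /card_gt0P[w wi] : (0 < #|G i|)%N by rewrite card_edge.
by apply: le_trans (xv w); rewrite (bigD1 i) //= lerDl; apply: sumr_ge0 => *.
Qed.

Lemma polyhedron_segment u v x : P u -> P v -> segment u v x -> P x.
Proof.
move=> [u0 uv uS] [v0 vv vS] [t [t0 t1 ->]].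
have t1' : 0 <= 1 - t by rewrite subr_ge0.
have sumE (Q : pred 'I_n) : \sum_(i < n | Q i) ((1 - t) *: u + t *: v) 0 i =
    (1 - t) * \sum_(i < n | Q i) u 0 i + t * \sum_(i < n | Q i) v 0 i.
  by rewrite !mulr_sumr -big_split; apply: eq_bigr => i _; rewrite !mxE.
have conv (a b c : R) : a <= c -> b <= c -> (1 - t) * a + t * b <= c by nra.
split=> [i|w|S k Sk].
- by rewrite !mxE; have := u0 i; have := v0 i; nra.
- by rewrite (sumE (fun i => w \in G i)) conv.
- by rewrite (sumE (fun i => G i \subset S)%SET) conv // ?uS ?vS.
Qed.

(** The form with coefficients 1 on [M] and -1 elsewhere is maximal only there, because every
    coordinate lies between 0 and 1. *)
Lemma indicator_vertex M : matching G M -> is_vertex P (indicator R M).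
Proof.
move=> mM; pose c : 'rV[R]_n := \row_i (if i \in M then 1 else -1).
pose slack x i := if i \in M then 1 - x 0 i else x 0 i.
have slackE x : #|M|%:R - linear_form c x = \sum_i slack x i.
  rewrite -sum1_card natr_sum big_mkcond -sumrB; apply: eq_bigr => i _.
  by rewrite /slack mxE; case: (i \in M); rewrite ?mul1r ?mulN1r ?sub0r ?opprK.
have slack_ge0 x i : P x -> 0 <= slack x i.
  move=> Px; rewrite /slack; case: (i \in M); first by rewrite subr_ge0 polyhedron_le1.
  by case: Px.
exists c, #|M|%:R; split=> [x Px|].
  by rewrite -subr_ge0 slackE sumr_ge0 // => i _; apply: slack_ge0.
apply/seteqP; split=> x /=.
  move=> ->; split; first exact: indicator_in_polyhedron.
  apply/eqP; rewrite eq_sym -subr_eq0 slackE big1 // => i _.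
  by rewrite /slack mxE; case: (i \in M); rewrite ?subrr.
move=> [Px cx]; apply/rowP => i; rewrite mxE.
have /psumr_eq0P/(_ i isT) : \sum_i slack x i = 0 by rewrite -slackE cx subrr.
rewrite /slack => h; have {h} : slack x i = 0.
  by apply: h => // j _; apply: slack_ge0.
by rewrite /slack; case: (i \in M) => // /eqP; rewrite subr_eq0 => /eqP <-.
Qed.

(* The maximal face of the functional [\sum_j (x_(r j) + x_(r j+1)) - \sum_(i notin r) x_i]
   is the segment: equality forces consecutive entries to sum to 1. *)
Lemma alternating_adjacent k (r : 'I_k.+1 -> 'I_n) : is_path G r -> injective r ->
  (forall a b : 'I_k.+1, a != b -> odd a = odd b -> ~ share_vertex G (r a) (r b)) ->
  exists u v, adjacent P u v /\ u - v = alternating_vector r.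
Proof.
move=> pr r_inj par.
(* The edges at even and at odd positions give the two matchings. *)
pose A (b : bool) : {set 'I_n} := [set r j | j : 'I_k.+1 & odd j == b]%SET.
have memA b (j : 'I_k.+1) : (r j \in A b) = (odd j == b).
  apply/imsetP/idP => [[i]|jb]; last by exists j; rewrite ?inE.
  by rewrite inE => ib /r_inj ->.
have outA b i : (forall j, r j != i) -> (i \in A b) = false.
  by move=> ri; apply/imsetP => -[j _ e]; have := ri j; rewrite e eqxx.
have mA b : matching G (A b).
  apply/matchingP => w _ _ /imsetP[i + ->] /imsetP[j + ->]; rewrite !inE => ib jb wi wj.
  have [-> //|nij] := eqVneq i j; case: (par i j nij); first by rewrite (eqP ib) (eqP jb).
  by exists w.
pose u := indicator R (A false); pose v := indicator R (A true).
have uvE : u - v = alternating_vector r.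
  apply/rowP => i; rewrite !mxE.
  have [/existsP[j /eqP <-]|ri] := boolP [exists j, r j == i].
    by rewrite alternating_vectorE // !memA -signr_odd; case: (odd j); rewrite ?subr0 ?sub0r.
  have {}ri j : r j != i by apply: contra ri => rj; apply/existsP; exists j.
  by rewrite alternating_vector_out // !outA // subrr.
exists u, v; split=> //.
have Pu : P u by exact: indicator_in_polyhedron.
have Pv : P v by exact: indicator_in_polyhedron.
split; [exact: indicator_vertex|exact: indicator_vertex| |].
  move/eqP; rewrite -subr_eq0 uvE => /eqP/rowP/(_ (r ord0)).
  by rewrite alternating_vectorE // mxE => /eqP; rewrite oner_eq0.
pose q j := r (inord j).
have qE (j : 'I_k.+1) : q j = r j by rewrite /q inord_val.
pose off i := [forall j, r j != i].
pose c : 'rV[R]_n :=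
  \sum_(j < k) (delta_mx 0 (q j) + delta_mx 0 (q j.+1)) - \row_i (off i)%:R.
pose slack x j := 1 - x 0 (q j) - x 0 (q j.+1).
have slackE x : k%:R - linear_form c x =
    \sum_(j < k) slack x j + \sum_(i < n | off i) x 0 i.
  rewrite linear_formBl linear_form_pred linear_formC linear_form_sumr opprB addrA addrAC.
  congr (_ + _); rewrite -[k in k%:R]card_ord -sum1_card natr_sum -sumrB.
  by apply: eq_bigr => j _; rewrite linear_formDr !linear_form_delta opprD addrA.
have slack_ge0 x j : P x -> (j < k)%N -> 0 <= slack x j.
  move=> Px jk; have j1 : (inord j.+1 : 'I_k.+1) = (inord j : 'I_k.+1).+1 :> nat.
    by rewrite !inordK // ltnS // ltnW.
  have [w [wi wj]] := pr _ _ j1.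
  rewrite /slack -addrA -opprD subr_ge0; apply: polyhedron_pair_le1 wi wj _ => //.
  rewrite (inj_eq r_inj); apply/eqP => /(congr1 (@nat_of_ord _)).
  by rewrite j1; lia.
have slacks_ge0 x : P x -> 0 <= \sum_(j < k) slack x j.
  by move=> Px; apply: sumr_ge0 => j _; apply: slack_ge0.
have offs_ge0 x : P x -> 0 <= \sum_(i < n | off i) x 0 i.
  by move=> [x0 _ _]; apply: sumr_ge0.
exists c, k%:R; split=> [x Px|].
  by rewrite -subr_ge0 slackE addr_ge0 ?slacks_ge0 ?offs_ge0.
have tight b : linear_form c (indicator R (A b)) = k%:R.
  apply/eqP; rewrite eq_sym -subr_eq0 slackE !big1 ?addr0 // => [i /forallP ri|j _].
    by rewrite mxE outA.
  rewrite /slack !mxE !memA !inordK /=; try by have := ltn_ord j; lia.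
  by case: (odd j); case: b; rewrite /= ?subr0 ?subrr.
apply/seteqP; split=> x.
  move=> xs; split; first exact: polyhedron_segment xs.
  case: xs => t [_ _ ->] /=.
  by rewrite linear_formDr !linear_formZr !tight -mulrDl subrK mul1r.
move=> [Px /= cx].
have /eqP : \sum_(j < k) slack x j + \sum_(i < n | off i) x 0 i = 0.
  by rewrite -slackE cx subrr.
rewrite paddr_eq0 ?slacks_ge0 ?offs_ge0 // => /andP[/eqP sl0 /eqP of0].
have {}sl0 j : (j < k)%N -> slack x j = 0.
  move=> jk; have /psumr_eq0P h := sl0.
  by apply: (h _ (Ordinal jk)) => // i _; exact: slack_ge0.
have {}of0 i : off i -> x 0 i = 0.
  by have /psumr_eq0P h := of0; apply: h => l _; case: Px.
have alt j : (j <= k)%N -> x 0 (q j) = if odd j then 1 - x 0 (q 0%N) else x 0 (q 0%N).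
  elim: j => // j IHj jk; have := sl0 j jk; rewrite /slack IHj ?(ltnW jk) //=.
  by case: (odd j) => /=; lra.
(* Coordinate [q 0] is 1 at [u] and 0 at [v], which determines the parameter. *)
exists (1 - x 0 (q 0%N)); split.
- by rewrite subr_ge0 polyhedron_le1.
- by rewrite gerBl; case: Px.
apply/rowP => i; rewrite !mxE.
have [offi|] := boolP (off i).
  have /forallP ri := offi; rewrite (of0 i offi) (outA false i ri) (outA true i ri).
  by rewrite !mulr0 addr0.
rewrite negb_forall => /existsP[j]; rewrite negbK => /eqP <-.
rewrite !memA -qE (alt j (leq_ord j)).
by case: (odd j) => /=; ring.
Qed.

(** Distinct positions of equal parity never share a vertex: sharing pairs are consecutive, or the
    closing pair of an even cycle, whose positions 0 and [k] also differ in parity. *)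
Lemma simple_adjacent k (r : 'I_k.+1 -> 'I_n) :
  simple_path G r \/ (simple_cycle G r /\ ~~ odd k.+1) ->
  exists u v, adjacent P u v /\ u - v = alternating_vector r.
Proof.
have sym (a b : 'I_k.+1) : share_vertex G (r a) (r b) -> share_vertex G (r b) (r a).
  by move=> [w [wa wb]]; exists w.
case=> [[pr r_inj simp]|[[[pr _] r_inj simp] ev]]; apply: alternating_adjacent => // a b.
  case: (ltngtP a b) => [ab|ba|/val_inj ->]; last by rewrite eqxx.
    by move=> _ par /(simp a b ab) e; rewrite e /= in par; case: (odd a) par.
  by move=> _ par /sym /(simp b a ba) e; rewrite e /= in par; case: (odd b) par.
have no (i j : 'I_k.+1) : (i < j)%N -> odd i = odd j -> share_vertex G (r i) (r j) -> False.
  move=> ij par /(simp i j ij)[e|[i0 jk]].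
    by rewrite e /= in par; case: (odd i) par.
  by move: par ev; rewrite i0 jk /= => <-.
case: (ltngtP a b) => [ab|ba|/val_inj ->]; last by rewrite eqxx.
  by move=> _ par; apply: no.
by move=> _ par /sym; apply: no.
Qed.

Lemma adjacent_simple u v : adjacent P u v -> exists k (r : 'I_k.+1 -> 'I_n),
  (simple_path G r \/ (simple_cycle G r /\ ~~ odd k.+1)) /\
  exists b : bool, u - v = (-1) ^+ b *: alternating_vector r.
Proof.
move=> [/vertex_matching[M mM ->] /vertex_matching[N mN ->] nuv [c [b [cb face]]]].
have nMN : M != N by apply: contra_notN nuv => /eqP ->.
have [k [r [sr rD sep col]]] := alternating_component mM mN nMN.
(* The sign is positive when the first edge belongs to [M]. *)
exists k, r; split=> //; exists (r ord0 \notin M).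
set K := [set r j | j : 'I_k.+1]%SET in sep.
have r_inj : injective r by case: sr => [[]|[[]]].
have inP x : segment (indicator R M) (indicator R N) x -> linear_form c x = b.
  by rewrite face => -[].
have cM : linear_form c (indicator R M) = b.
  by apply: inP; exists 0; rewrite lexx ler01 subr0 scale1r scale0r addr0.
have cN : linear_form c (indicator R N) = b.
  by apply: inP; exists 1; rewrite lexx ler01 subrr scale1r scale0r add0r.
have P1 := indicator_in_polyhedron R (matching_swap sep mM mN).
have P2 : P (indicator R (swap K N M)).
  by apply: indicator_in_polyhedron; apply: matching_swap => //; rewrite finset.setUC.
(* The values of [c] at the two swapped matchings are at most [b] and sum to twice [b], so both
   equal [b]. *)
have : segment (indicator R M) (indicator R N) (indicator R (swap K M N)).
  rewrite face; split=> //=; have := congr1 (linear_form c) (indicator_swap R K M N).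
  by rewrite !linear_formDr cM cN; have := cb _ P1; have := cb _ P2; lra.
move=> [t [_ _ /rowP eqt]].
have memK j : r j \in K by apply/imsetP; exists j.
(* The first edge lies in just one of [M] and [N], and the swap agrees with [N] there. Hence the
   swap is [N] itself, and [M] and [N] differ only on [K]. *)
have t1 : t = 1.
  have := eqt (r ord0); have := rD ord0; rewrite !mxE !inE memK /=.
  case: (r ord0 \in M); case: (r ord0 \in N) => //= _; lra.
apply/rowP => i; have := eqt i; rewrite t1 subrr scale0r add0r !mxE !inE.
have [/existsP[j /eqP <-] _|ri] := boolP [exists j, r j == i]; last first.
  have {}ri j : r j != i by apply: contra ri => rj; apply/existsP; exists j.
  rewrite alternating_vector_out // mulr0; have -> : (i \in K) = false.
    by apply/imsetP => -[j _ e]; have := ri j; rewrite e eqxx.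
  by rewrite andbF orbF /= => ->; rewrite mul1r subrr.
rewrite alternating_vectorE // -[X in _ * X]signr_odd -signr_addb.
have := col j; have := rD j; rewrite !inE.
by case: (r j \in M); case: (r j \in N) => //= _; case: (odd j); case: (r ord0 \in M);
  rewrite ?subr0 ?sub0r.
Qed.

End MatchingAdjacency.

Lemma adjacent_sym (R : realType) n (P : set 'rV[R]_n) u v : adjacent P u v -> adjacent P v u.
Proof.
move=> [Pu Pv uv fuv]; split=> //; first by move=> e; apply: uv.
suff -> : segment v u = segment u v by [].
by apply/seteqP; split=> x [t [t0 t1 ->]]; exists (1 - t);
  rewrite subr_ge0 t1 gerBl t0 subKr addrC.
Qed.

(** * Orientations and regions *)

Section Orientations.
Variables (R : realType) (n : nat) (P : set 'rV[R]_n).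

Definition edge_directions : set 'rV[R]_n :=
  [set d | exists u v, adjacent P u v /\ d = v - u].

Definition orientation (f : 'rV[R]_n -> R) : set ('rV[R]_n * 'rV[R]_n) :=
  [set a | adjacent P a.1 a.2 /\ f a.1 < f a.2].

Lemma inducesP (alpha : 'rV[R]_n) O : induces P (linear_form alpha) O <->
  generic edge_directions alpha /\ O = orientation (linear_form alpha).
Proof.
split=> -[sep ->]; split=> //.
  move=> _ [u [v [uv ->]]].
  by rewrite linear_formBr => /eqP; rewrite subr_eq0 => /eqP /esym; apply: sep.
move=> u v uv e; apply: (sep (v - u)); first by exists u, v.
by rewrite linear_formBr e subrr.
Qed.

(** An orientation records the sign of the form on each edge direction, that is, the sign vector
    that describes the component. *)
Lemma inducing_coefficientsE x : generic edge_directions x ->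
  inducing_coefficients P (orientation (linear_form x)) =
  connected_component (generic edge_directions) x.
Proof.
move=> gx; rewrite connected_component_generic //; apply/seteqP; split=> y /=.
  move=> /inducesP[gy eO]; split=> // d [u [v [uv ->]]].
  rewrite !linear_formBr !subr_gt0.
  have /seteqP[xy yx] := eO.
  by apply/idP/idP => h; [have [] := yx (u, v) (conj uv h)|have [] := xy (u, v) (conj uv h)].
move=> [gy sgn]; apply/inducesP; split=> //; apply/seteqP.
have sgn' u v : adjacent P u v ->
    (linear_form y u < linear_form y v) = (linear_form x u < linear_form x v).
  by move=> uv; rewrite -subr_gt0 -[RHS]subr_gt0 -!linear_formBr sgn //; exists u, v.
by split=> -[u v] [/= uv h]; split=> //=; rewrite ?sgn' // -sgn'.
Qed.

(** Any member of [inducing_coefficients P O] induces [O] and so determines it, which gives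
    injectivity. For surjectivity, a generic vector is itself the coefficient vector of a form
    inducing an orientation. *)
Lemma orientations_bij :
  let RG := [set D | exists2 x, generic edge_directions x &
               D = connected_component (generic edge_directions) x] in
  (forall O, LP_orientations P O -> RG (inducing_coefficients P O)) /\
  set_bij (LP_orientations P) RG (inducing_coefficients P).
Proof.
move=> RG.
have coefs O : LP_orientations P O -> exists2 x, generic edge_directions x &
    O = orientation (linear_form x).
  move=> [phi iO]; have [x xE] := linear_formE phi.
  have /inducesP[gx ->] : induces P (linear_form x) O; last by exists x.
  by rewrite -(_ : (phi : 'rV[R]_n -> R) = linear_form x) //; apply/funext.
have inRG O : LP_orientations P O -> RG (inducing_coefficients P O).
  by move=> /coefs[x gx ->]; exists x => //; exact: inducing_coefficientsE.
split=> //; split=> // [O1 O2|].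
  rewrite !inE => /coefs[x gx ->] /coefs[y gy ->] e.
  have : inducing_coefficients P (orientation (linear_form x)) x by apply/inducesP.
  by rewrite e => /inducesP[].
move=> _ [x gx ->]; exists (orientation (linear_form x)); last exact: inducing_coefficientsE.
have lin : linear (fun y : 'rV[R]_n => linear_form x y : R^o).
  by move=> a u v; rewrite linear_formDr linear_formZr.
pose phi := HB.pack (fun y : 'rV[R]_n => linear_form x y : R^o)
  (GRing.isLinear.Build R 'rV[R]_n R^o *:%R _ lin) : {linear 'rV[R]_n -> R^o}.
by exists phi; apply/inducesP.
Qed.

End Orientations.

(** By [simple_adjacent] and [adjacent_simple], the edge directions are up to sign the normals of
    the hyperplanes, and the sign does not affect vanishing. *)
Lemma generic_edge_directions (R : realType) (V : finType) n (G : numbered_graph V n) :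
  generic (edge_directions (matching_polyhedron R G)) =
  ~` (\bigcup_(H in matching_arrangement R G) H).
Proof.
apply/seteqP; split=> x.
  move=> gx [_ [k [r [sr ->]]]]; rewrite /alternating_hyperplane /=.
  have [u [v [uv e]]] := simple_adjacent R sr.
  rewrite -linear_form_alternating -e; apply: gx.
  by exists v, u; split=> //; apply: adjacent_sym.
move=> nx _ [u [v [/adjacent_sym/adjacent_simple[k [r [sr [b ->]]]] ->]]] e.
apply: nx; exists (alternating_hyperplane r); first by exists k, r.
rewrite /alternating_hyperplane /= -linear_form_alternating.
by move/eqP: e; rewrite linear_formZr mulf_eq0 signr_eq0 /= => /eqP.
Qed.

Theorem theorem2 (R : realType) (V : finType) (n : nat)
    (G : numbered_graph V n) :
  let L := LP_orientations (matching_polyhedron R G) in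
  let RG := regions (matching_arrangement R G) in
  let F := inducing_coefficients (matching_polyhedron R G) in
  (forall O, L O -> RG (F O)) /\ set_bij L RG F.
Proof.
by move=> L RG F; rewrite /RG /regions -generic_edge_directions; exact: orientations_bij.
Qed.
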